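(* Suppose $T$ is a normal tree. Then: (1) if $T$ is absolutely rigid or totally rigid, then $T$ is rigid; (2) if $T$ is absolutely totally rigid, then it is totally rigid and absolutely rigid; (3) if $T$ has the UBP, then it is totally rigid; (4) if $T$ is absolutely UBP, then it has the UBP and is absolutely totally rigid.
   Context: A tree is a partial order with a unique minimal element in which the predecessors of every node are well ordered. For $\alpha\le\omega_1$, an $\alpha$-tree is a tree of height $\alpha$ with countable levels; it is normal if every node has at least two immediate successors (except those on the top level if $\alpha$ is a successor), nodes on limit levels are determined by their predecessors, and every node has successors on every higher level below $\alpha$. $T_p=\{q: q\ge_T p\}$. When forcing with a tree the order is reversed. $T$ is rigid if it has no nontrivial automorphism; totally rigid if $T_p\not\cong T_q$ for distinct nodes $p,q$; has the UBP if $1\Vdash_T$ ''$T$ has exactly one new cofinal branch''; absolutely rigid / absolutely totally rigid / absolutely UBP if $1\Vdash_T$ ''$T$ is rigid / totally rigid / has the UBP'', respectively. *)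

(* Defs.v *)
From Stdlib Require Import Relation_Definitions.

Set Implicit Arguments.
Unset Strict Implicit.

(** * Trees *)

Definition well_ordered_on (A : Type) (le : A -> A -> Prop) (D : A -> Prop) :=
  forall S : A -> Prop, (forall x, S x -> D x) -> (exists x, S x) ->
  exists m, S m /\ forall x, S x -> le m x.

Definition countable_set (A : Type) (D : A -> Prop) :=
  exists f : A -> nat, forall x y, D x -> D y -> f x = f y -> x = y.

Definition minimal (A : Type) (le : A -> A -> Prop) (m : A) :=
  forall x, le x m -> x = m.

Record tree := Tree {
  node :> Type;
  tle : node -> node -> Prop;
  root : node;
  tle_order : order node tle;
  root_minimal : minimal tle root;
  root_unique : forall m, minimal tle m -> m = root;
  predecessors_wo :
    forall t, well_ordered_on tle (fun s => tle s t /\ s <> t)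
}.

Arguments tle {t} _ _ : rename.
Arguments root {t} : rename.

Definition tlt (T : tree) (s t : T) := tle s t /\ s <> t.

Definition cone (T : tree) (p : T) : T -> Prop := fun q => tle p q.

Definition immediate_successor (T : tree) (t s : T) :=
  tlt t s /\ ~ exists u, tlt t u /\ tlt u s.

(** An ordinal is given by a well-ordered type of that order type, whose
    elements stand for the smaller ordinals. *)
Record ordinal := Ordinal {
  below :> Type;
  ole : below -> below -> Prop;
  ole_order : order below ole;
  ole_wo : well_ordered_on ole (fun _ => True)
}.

Arguments ole {o} _ _ : rename.

Definition olt (alpha : ordinal) (b c : alpha) := ole b c /\ b <> c.

(** [alpha <= omega_1]: every ordinal below [alpha] is countable. *)
Definition le_omega1 (alpha : ordinal) :=
  forall b : alpha, countable_set (fun c => olt c b).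

(** [b + 1 = alpha]. *)
Definition is_top (alpha : ordinal) (b : alpha) := forall c, ole c b.

Definition is_limit (alpha : ordinal) (b : alpha) :=
  (exists c, olt c b) /\ forall c, olt c b -> exists d, olt c d /\ olt d b.

(** [level t] is the order type of the predecessors of [t]: by the first two
    axioms on [level] it restricts to an isomorphism from [{s | s < t}] onto
    [{b | b < level t}], which determines it. *)
Record alpha_tree (alpha : ordinal) := AlphaTree {
  tree_of :> tree;
  level : tree_of -> alpha;
  level_lt : forall s t, tlt s t -> olt (level s) (level t);
  level_onto : forall t b, olt b (level t) -> exists s, tlt s t /\ level s = b;
  level_inhabited : forall b, exists t, level t = b;
  level_countable : forall b, countable_set (fun t => level t = b)
}.

Arguments level {alpha a} _ : rename.

Record normal (alpha : ordinal) (T : alpha_tree alpha) : Prop := Normal {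
  normal_splitting : forall t : T, ~ is_top (level t) ->
    exists s1 s2, s1 <> s2 /\
      immediate_successor t s1 /\ immediate_successor t s2;
  normal_limit : forall s t : T, is_limit (level s) -> is_limit (level t) ->
    (forall u, tlt u s <-> tlt u t) -> s = t;
  normal_extension : forall (t : T) (b : alpha), olt (level t) b ->
    exists s, tlt t s /\ level s = b
}.

(** * Universes and forcing *)

(** A universe of sets, as far as statements about subsets of, and relations
    on, sets of the ground model are concerned.  [form] is the type of the
    statements about the universe.  An element of [bit] names a subset (in the
    universe) of a one-point set, so that [A -> bit] is the type of (names of)
    the subsets of [A] that the universe contains, and [A -> B -> bit] that of
    the relations; [is_in (X a)] is the statement "[a] is in [X]".  [fground P]
    is a fact [P] about elements of the ground model. *)
Record universe := Universe {
  form : Type;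
  bit : Type;
  is_in : bit -> form;
  fground : Prop -> form;
  fand : form -> form -> form;
  fimp : form -> form -> form;
  fall : forall A : Type, (A -> form) -> form;
  fex : forall A : Type, (A -> form) -> form
}.

Arguments is_in {u} _ : rename.
Arguments fground {u} _ : rename.
Arguments fand {u} _ _ : rename.
Arguments fimp {u} _ _ : rename.
Arguments fall {u} A _ : rename.
Arguments fex {u} A _ : rename.

Declare Scope form_scope.
Delimit Scope form_scope with form.
Bind Scope form_scope with form.

Notation "[[ P ]]" := (fground P%type) (at level 0, P at level 200) : form_scope.
Notation "phi &&& psi" := (fand phi psi)
  (at level 80, right associativity) : form_scope.
Notation "phi ==> psi" := (fimp phi psi)
  (at level 90, right associativity) : form_scope.
Notation "!! phi" := (fimp phi (fground False))
  (at level 75, right associativity) : form_scope.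
Notation "'ALL' x : A , phi" := (fall A%type (fun x => phi))
  (at level 200, x name, A at level 200) : form_scope.
Notation "'EX' x : A , phi" := (fex A%type (fun x => phi))
  (at level 200, x name, A at level 200) : form_scope.

Local Open Scope form_scope.

Definition fiff (M : universe) (phi psi : form M) : form M :=
  (phi ==> psi) &&& (psi ==> phi).

(** The ground model. *)
Definition V : universe :=
  @Universe Prop Prop
    (fun b => b) (fun P => P) and (fun P Q => P -> Q)
    (fun A P => forall x : A, P x) (fun A P => exists x : A, P x).

Section Forcing.

Variables (T : tree) (M : universe).

(** "For all (some) conditions [q] stronger than [p]": forcing with a tree
    reverses its order. *)
Definition all_stronger (p : T) (phi : T -> form M) : form M :=
  ALL q : T, [[ tle p q ]] ==> phi q.
Definition some_stronger (p : T) (phi : T -> form M) : form M :=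
  EX q : T, [[ tle p q ]] &&& phi q.

(** The extension of [M] by forcing with [T].  A statement [phi] about it is
    given by the statements "[p] forces [phi]", for [p] in [T], about [M].  A
    name of a subset of [A] is a subset, in [M], of [A * T]: the pair [(a, s)]
    puts [a] into the subset as soon as [s] is in the generic filter.  So [p]
    forces that [a] is in the subset when, densely below [p], there are
    conditions [r] stronger than some [s] such that [(a, s)] is in the name.
    The other clauses are the usual ones. *)
Definition extension : universe :=
  @Universe (T -> form M) (T -> bit M)
    (fun u p => all_stronger p (fun q => some_stronger q (fun r =>
       EX s : T, [[ tle s r ]] &&& is_in (u s))))
    (fun P p => [[ P ]])
    (fun phi psi p => phi p &&& psi p)
    (fun phi psi p => all_stronger p (fun q => phi q ==> psi q))
    (fun A phi p => ALL x : A, phi x p)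
    (fun A phi p => all_stronger p (fun q => some_stronger q (fun r =>
       EX x : A, phi x r))).

(** The canonical name, in [extension], of a subset of [A] in [M]. *)
Definition check (A : Type) (X : A -> bit M) : A -> bit extension :=
  fun a _ => X a.

(** "1 forces [phi]"; the weakest condition is the root of [T]. *)
Definition forced (phi : form extension) : form M := phi root.

End Forcing.

Arguments check T {M A} X.

(** * Rigidity notions, as statements about a universe *)

Section InUniverse.

Variable M : universe.

(** [R] is the graph of an isomorphism from the suborder [D] of [T] onto the
    suborder [E]. *)
Definition isomorphism (T : tree) (D E : T -> Prop) (R : T -> T -> bit M) :
    form M :=
  (ALL x : T, ALL y : T, is_in (R x y) ==> [[ D x /\ E y ]]) &&&
  (ALL x : T, [[ D x ]] ==> EX y : T, is_in (R x y)) &&&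
  (ALL y : T, [[ E y ]] ==> EX x : T, is_in (R x y)) &&&
  (ALL x : T, ALL y : T, ALL y' : T,
     is_in (R x y) ==> is_in (R x y') ==> [[ y = y' ]]) &&&
  (ALL x : T, ALL x' : T, ALL y : T,
     is_in (R x y) ==> is_in (R x' y) ==> [[ x = x' ]]) &&&
  (ALL x : T, ALL y : T, ALL x' : T, ALL y' : T,
     is_in (R x y) ==> is_in (R x' y') ==> [[ tle x x' <-> tle y y' ]]).

Definition automorphism (T : tree) (R : T -> T -> bit M) : form M :=
  isomorphism (fun _ => True) (fun _ => True) R.

Definition nontrivial (T : tree) (R : T -> T -> bit M) : form M :=
  EX x : T, EX y : T, is_in (R x y) &&& [[ x <> y ]].

Definition rigid (T : tree) : form M :=
  !! (EX R : T -> T -> bit M, automorphism R &&& nontrivial R).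

Definition totally_rigid (T : tree) : form M :=
  ALL p : T, ALL q : T, [[ p <> q ]] ==>
    !! (EX R : T -> T -> bit M, isomorphism (cone p) (cone q) R).

(** A branch is a maximal chain; it is cofinal if it meets every level. *)
Definition cofinal_branch (alpha : ordinal) (T : alpha_tree alpha)
    (B : T -> bit M) : form M :=
  (ALL s : T, ALL t : T, is_in (B s) ==> is_in (B t) ==>
     [[ tle s t \/ tle t s ]]) &&&
  (ALL t : T, (ALL s : T, is_in (B s) ==> [[ tle s t \/ tle t s ]]) ==>
     is_in (B t)) &&&
  (ALL b : alpha, EX t : T, is_in (B t) &&& [[ level t = b ]]).

Definition same_set (A : Type) (X Y : A -> bit M) : form M :=
  ALL a : A, fiff (is_in (X a)) (is_in (Y a)).

End InUniverse.

Arguments rigid M T : clear implicits.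
Arguments totally_rigid M T : clear implicits.

Section Absolute.

Variables (M : universe) (alpha : ordinal) (T : alpha_tree alpha).

(** New in the extension of [M] by [T], that is, not in [M]. *)
Definition new_cofinal_branch (B : T -> bit (extension T M)) :
    form (extension T M) :=
  cofinal_branch B &&& ALL X : T -> bit M, !! same_set B (check T X).

Definition exactly_one_new_cofinal_branch : form (extension T M) :=
  EX B : T -> bit (extension T M), new_cofinal_branch B &&&
    ALL C : T -> bit (extension T M), new_cofinal_branch C ==> same_set C B.

Definition UBP : form M := forced exactly_one_new_cofinal_branch.

End Absolute.

Arguments UBP M {alpha} T.

Definition absolutely_rigid (T : tree) : form V :=
  forced (rigid (extension T V) T).

Definition absolutely_totally_rigid (T : tree) : form V :=
  forced (totally_rigid (extension T V) T).

Definition absolutely_UBP (alpha : ordinal) (T : alpha_tree alpha) : form V :=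
  forced (UBP (extension T V) T).

(* Main.v *)
(** A forcing notion [P] has a Boolean-valued universe, whose statements are the
    regular open sets of conditions that force them.  [V] is that of the trivial
    notion, and if [M] is that of [P], its extension by [T] is that of the
    product of [T] and [P]; so each claim becomes one about all forcing notions,
    read for the trivial one and for [T].

    A projection of [Q] onto [P] turns names over [P] into names over [Q], so
    that total rigidity and rigidity descend from [Q] to [P].  An automorphism
    moving [x] to [y] restricts to an isomorphism of cones.  If [T] has the UBP
    and [R] maps the cone of [s] onto that of [t], the image under [R] of the
    generic branch through [s] is a new cofinal branch through [t], so it is the
    generic branch; hence [s] forces [t] into the generic branch, so that
    [t <= s], and [s = t] by symmetry.  The UBP descends as well: a new cofinal
    branch over [P] remains new over [Q], by mutual genericity of [T] and [Q],
    hence is the generic branch. *)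

From Stdlib Require Import Relation_Definitions Classical.
Require Import Defs.

Set Implicit Arguments.
Unset Strict Implicit.

#[local] Obligation Tactic := idtac.

(** * Normal trees *)

Lemma tle_refl (T : tree) (t : T) : tle t t.
Proof. apply (tle_order T). Qed.

Lemma tle_trans (T : tree) (s t u : T) : tle s t -> tle t u -> tle s u.
Proof. apply (tle_order T). Qed.

Lemma tle_antisym (T : tree) (s t : T) : tle s t -> tle t s -> s = t.
Proof. apply (tle_order T). Qed.

#[local] Hint Resolve tle_refl : core.

Definition comparable (T : tree) (s t : T) := tle s t \/ tle t s.

Section Trees.

Context (T : tree).

Lemma predecessors_comparable (s t u : T) :
  tle s u -> tle t u -> comparable s t.
Proof.
  intros Hs Ht.
  destruct (classic (s = u)) as [->|Hsu]; [now right|].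
  destruct (classic (t = u)) as [->|Htu]; [now left|].
  destruct (@predecessors_wo T u (fun x => x = s \/ x = t)) as (m & Hm & Hle).
  - intros x [->| ->]; now split.
  - exists s. now left.
  - destruct Hm as [->| ->]; [left | right]; auto.
Qed.

Lemma comparable_below (s s' t t' : T) :
  tle s s' -> tle t t' -> comparable s' t' -> comparable s t.
Proof.
  intros Hs Ht [H|H]; [apply predecessors_comparable with t'
    | apply predecessors_comparable with s']; eauto using tle_trans.
Qed.

Lemma root_least (t : T) : tle root t.
Proof.
  destruct (classic (exists s, tlt s t)) as [Hpred|Hpred].
  - destruct (@predecessors_wo T t (fun s => tlt s t)) as (m & [Hm Hne] & Hle);
      auto.
    enough (m = root) by congruence.
    apply root_unique. intros x Hx. apply tle_antisym; [assumption|].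
    apply Hle. split; [eapply tle_trans; eauto|].
    intros ->. apply Hne. now apply tle_antisym.
  - enough (t = root) as -> by apply tle_refl.
    apply root_unique. intros x Hx. apply NNPP. intros Hxt. apply Hpred.
    exists x. now split.
Qed.

Lemma immediate_successor_least (t s u : T) :
  immediate_successor t s -> tlt t u -> comparable s u -> tle s u.
Proof.
  intros [_ Hs] Hu [H|H]; [exact H|].
  destruct (classic (u = s)) as [->|Hne]; [apply tle_refl|].
  exfalso. apply Hs. exists u. split; [exact Hu | now split].
Qed.

End Trees.

Section Ordinals.

Context (alpha : ordinal).

Definition limit_height := forall b : alpha, ~ is_top b.

Lemma ole_refl (b : alpha) : ole b b.
Proof. apply (ole_order alpha). Qed.

Lemma ole_trans (b c d : alpha) : ole b c -> ole c d -> ole b d.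
Proof. apply (ole_order alpha). Qed.

Lemma ole_antisym (b c : alpha) : ole b c -> ole c b -> b = c.
Proof. apply (ole_order alpha). Qed.

Lemma olt_not_ole (b c : alpha) : olt b c -> ~ ole c b.
Proof. intros [H Hne] H'. apply Hne. now apply ole_antisym. Qed.

Lemma olt_ole_trans (b c d : alpha) : olt b c -> ole c d -> olt b d.
Proof.
  intros Hbc Hcd. split; [eapply ole_trans; [apply Hbc | exact Hcd]|].
  intros ->. exact (olt_not_ole Hbc Hcd).
Qed.

Lemma ole_or_olt (b c : alpha) : ole b c \/ olt c b.
Proof.
  destruct (classic (b = c)) as [->|Hne]; [left; apply ole_refl|].
  destruct (@ole_wo alpha (fun x => x = b \/ x = c)) as (m & Hm & Hle); auto.
  - exists b. now left.
  - destruct Hm as [->| ->]; [left | right; split]; auto.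
Qed.

Lemma olt_well_founded : well_founded (@olt alpha).
Proof.
  intros b. apply NNPP. intros Hb.
  destruct (@ole_wo alpha (fun c => ~ Acc (@olt alpha) c)) as (m & Hm & Hle);
    eauto.
  apply Hm. constructor. intros c Hc. apply NNPP. intros Hnc.
  exact (olt_not_ole Hc (Hle c Hnc)).
Qed.

End Ordinals.

Section Levels.

Context (alpha : ordinal) (T : alpha_tree alpha).

Lemma level_ole (s t : T) : tle s t -> ole (level s) (level t).
Proof.
  intros Hst. destruct (classic (s = t)) as [->|Hne]; [apply ole_refl|].
  apply (level_lt (conj Hst Hne)).
Qed.

Lemma comparable_level_eq (s t : T) :
  comparable s t -> level s = level t -> s = t.
Proof.
  intros Hst Hl. apply NNPP. intros Hne. destruct Hst as [H|H].
  - now apply (level_lt (conj H Hne)).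
  - now apply (level_lt (conj H (not_eq_sym Hne))).
Qed.

Lemma tle_of_level (s t u : T) :
  tle s u -> tle t u -> ole (level s) (level t) -> tle s t.
Proof.
  intros Hs Ht Hl.
  pose proof (predecessors_comparable Hs Ht) as Hst.
  destruct Hst as [H|H]; [exact H|].
  rewrite (comparable_level_eq (or_intror H)); [apply tle_refl|].
  apply ole_antisym; [exact Hl | now apply level_ole].
Qed.

Lemma level_below (t : T) (b : alpha) :
  ole b (level t) -> exists s, tle s t /\ level s = b.
Proof.
  intros Hb. destruct (classic (b = level t)) as [->|Hne].
  - now exists t.
  - destruct (level_onto (conj Hb Hne)) as (s & [Hs _] & Hl). eauto.
Qed.

Context (T_normal : normal T).

Lemma level_above (t : T) (b : alpha) :
  exists s, tle t s /\ ole b (level s).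
Proof.
  destruct (ole_or_olt b (level t)) as [H|H]; [eauto|].
  destruct (normal_extension T_normal H) as (s & [Hs _] & <-).
  exists s. split; [exact Hs | apply ole_refl].
Qed.

Context (limit : limit_height alpha).

Lemma incomparable_above (p q : T) :
  ~ tle q p -> exists s, tle p s /\ ~ comparable s q.
Proof.
  intros Hqp.
  destruct (classic (comparable p q)) as [Hpq|Hpq];
    [destruct Hpq as [Hpq|H]; [|contradiction] | now exists p].
  assert (Hlt : tlt p q) by (split; [exact Hpq|]; now intros ->).
  destruct (normal_splitting T_normal (limit (b := level p)))
    as (s1 & s2 & Hne & Hs1 & Hs2).
  apply NNPP. intros Hcomp. apply Hne.
  assert (below_q : forall s, immediate_successor p s -> tle s q).
  { intros s Hs. apply (immediate_successor_least Hs Hlt). apply NNPP.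
    intros Hsq. apply Hcomp. exists s. split; [apply Hs | exact Hsq]. }
  pose proof (predecessors_comparable (below_q s1 Hs1) (below_q s2 Hs2)) as Hcs.
  apply tle_antisym; eapply immediate_successor_least; eauto;
    [apply Hs2 | apply Hs1 | now apply or_comm].
Qed.

Lemma incomparable_successors (t : T) :
  exists s1 s2, tle t s1 /\ tle t s2 /\ ~ comparable s1 s2.
Proof.
  destruct (normal_splitting T_normal (limit (b := level t)))
    as (u & _ & _ & ((Htu & Hne) & _) & _).
  destruct (incomparable_above (p := t) (q := u)) as (s & Hs & Hsu).
  - intros Hut. apply Hne. now apply tle_antisym.
  - now exists s, u.
Qed.

End Levels.

(** * Regular open sets of conditions *)

(** As in [extension], the larger conditions are the stronger ones. *)
Record forcing_notion := ForcingNotion {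
  condition :> Type;
  cle : relation condition;
  cle_preorder : preorder condition cle
}.

Arguments cle {f} _ _ : rename.

Lemma cle_refl (P : forcing_notion) (p : P) : cle p p.
Proof. apply (cle_preorder P). Qed.

Lemma cle_trans (P : forcing_notion) (p q r : P) :
  cle p q -> cle q r -> cle p r.
Proof. apply (cle_preorder P). Qed.

#[local] Hint Resolve cle_refl : core.

Definition densely (P : forcing_notion) (D : P -> Prop) (p : P) :=
  forall q, cle p q -> exists r, cle q r /\ D r.

Record regular_open (P : forcing_notion) := RegularOpen {
  ro_mem :> P -> Prop;
  ro_mono : forall p q, cle p q -> ro_mem p -> ro_mem q;
  ro_dense : forall p, densely ro_mem p -> ro_mem p
}.

Section RegularOpenAlgebra.

Context (P : forcing_notion).

Program Definition regularize (D : P -> Prop) : regular_open P :=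
  {| ro_mem := densely D |}.
Next Obligation. intros D p q Hpq H r Hr. eauto using cle_trans. Qed.
Next Obligation.
  intros D p H q Hq. destruct (H q Hq) as (r & Hr & Hd).
  destruct (Hd r (cle_refl r)) as (s & Hs & Ds). eauto using cle_trans.
Qed.

Lemma densely_intro (D : P -> Prop) (p : P) :
  (forall q r, cle q r -> D q -> D r) -> D p -> densely D p.
Proof. intros mono Dp q Hq. eauto. Qed.

Program Definition ro_ground (A : Prop) : regular_open P :=
  {| ro_mem := fun _ => A |}.
Next Obligation. trivial. Qed.
Next Obligation. intros A p H. now destruct (H p (cle_refl p)). Qed.

Program Definition ro_and (X Y : regular_open P) : regular_open P :=
  {| ro_mem := fun p => X p /\ Y p |}.
Next Obligation. intros X Y p q Hpq []. split; eauto using ro_mono. Qed.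
Next Obligation.
  intros X Y p H. split; apply ro_dense; intros q Hq;
    destruct (H q Hq) as (r & Hr & Xr & Yr); eauto.
Qed.

Program Definition ro_imp (X Y : regular_open P) : regular_open P :=
  {| ro_mem := fun p => forall q, cle p q -> X q -> Y q |}.
Next Obligation. intros X Y p q Hpq H r Hr. eauto using cle_trans. Qed.
Next Obligation.
  intros X Y p H q Hq Xq. apply ro_dense. intros r Hr.
  destruct (H r) as (s & Hs & Hi); eauto using cle_trans.
  exists s. eauto using cle_trans, ro_mono.
Qed.

Program Definition ro_all (A : Type) (X : A -> regular_open P) :
    regular_open P :=
  {| ro_mem := fun p => forall a, X a p |}.
Next Obligation. intros A X p q Hpq H a. eauto using ro_mono. Qed.
Next Obligation.
  intros A X p H a. apply ro_dense. intros q Hq.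
  destruct (H q Hq) as (r & Hr & Xr). eauto.
Qed.

Definition ro_ex (A : Type) (X : A -> regular_open P) : regular_open P :=
  regularize (fun p => exists a, X a p).

(** The universe of names for the Boolean completion of [P].  A statement about
    it is identified with its truth value, so that [phi p] reads "[p] forces
    [phi]" and unfolds definitionally. *)
Definition boolean_valued : universe :=
  @Universe (regular_open P) (regular_open P)
    (fun X => X) ro_ground ro_and ro_imp ro_all ro_ex.

End RegularOpenAlgebra.

Section ForcedFormulas.

Local Open Scope form_scope.

Context (P : forcing_notion).

Notation VP := (boolean_valued P).

Lemma forces_exists (A : Type) (phi : A -> form VP) (a : A) (p : P) :
  phi a p -> (EX x : A, phi x) p.
Proof.
  intros H. apply densely_intro; [|now exists a].
  intros q r Hr []. eauto using ro_mono.
Qed.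

Lemma forces_not_exists (A : Type) (phi : A -> form VP) (p : P) :
  (!! EX a : A, phi a) p <-> forall a q, cle p q -> ~ phi a q.
Proof.
  split.
  - intros H a q Hq Ha. apply (H q Hq), (forces_exists (a := a)), Ha.
  - intros H q Hq Hex. destruct (Hex q (cle_refl q)) as (r & Hr & a & Ha).
    apply (H a r); eauto using cle_trans.
Qed.

Lemma forces_same_set (A : Type) (X Y : A -> regular_open P) (p : P) :
  same_set (M := VP) X Y p <->
  forall a q, cle p q -> X a q <-> Y a q.
Proof.
  split.
  - intros H a q Hq. destruct (H a). split; auto.
  - intros H a. split; intros q Hq; apply (H a q Hq).
Qed.

End ForcedFormulas.

Section Isomorphisms.

Context (P : forcing_notion) (T : tree).

Notation VP := (boolean_valued P).

Record iso_at (D E : T -> Prop) (R : T -> T -> regular_open P) (p : P) :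
    Prop := IsoAt {
  iso_dom : forall x y q, cle p q -> R x y q -> D x /\ E y;
  iso_total : forall x, D x -> densely (fun q => exists y, R x y q) p;
  iso_onto : forall y, E y -> densely (fun q => exists x, R x y q) p;
  iso_fun : forall x y y' q, cle p q -> R x y q -> R x y' q -> y = y';
  iso_inj : forall x x' y q, cle p q -> R x y q -> R x' y q -> x = x';
  iso_order : forall x y x' y' q, cle p q ->
    R x y q -> R x' y' q -> (tle x x' <-> tle y y')
}.

Lemma forces_isomorphism (D E : T -> Prop) (R : T -> T -> regular_open P)
    (p : P) :
  isomorphism (M := VP) D E R p <-> iso_at D E R p.
Proof.
  split.
  - intros (Hdom & Htot & Honto & Hfun & Hinj & Hord). constructor.
    + intros x y. apply Hdom.
    + intros x Dx. exact (Htot x p (cle_refl p) Dx).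
    + intros y Ey. exact (Honto y p (cle_refl p) Ey).
    + intros x y y' q Hq Hy. exact (Hfun x y y' q Hq Hy q (cle_refl q)).
    + intros x x' y q Hq Hx. exact (Hinj x x' y q Hq Hx q (cle_refl q)).
    + intros x y x' y' q Hq H. exact (Hord x y x' y' q Hq H q (cle_refl q)).
  - intros [Hdom Htot Honto Hfun Hinj Hord].
    refine (conj _ (conj _ (conj _ (conj _ (conj _ _))))); simpl.
    + intros x y. apply Hdom.
    + intros x q Hq Dx r Hr. eapply Htot; eauto using cle_trans.
    + intros y q Hq Ey r Hr. eapply Honto; eauto using cle_trans.
    + intros x y y' q Hq Hy r Hr Hy'.
      apply (Hfun x y y' r); eauto using cle_trans, ro_mono.
    + intros x x' y q Hq Hx r Hr Hx'.
      apply (Hinj x x' y r); eauto using cle_trans, ro_mono.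
    + intros x y x' y' q Hq H r Hr H'.
      apply (Hord x y x' y' r); eauto using cle_trans, ro_mono.
Qed.

Lemma iso_at_mono (D E : T -> Prop) (R : T -> T -> regular_open P) (p q : P) :
  cle p q -> iso_at D E R p -> iso_at D E R q.
Proof. rewrite <- !forces_isomorphism. apply ro_mono. Qed.

Lemma iso_at_inverse (D E : T -> Prop) (R : T -> T -> regular_open P) (p : P) :
  iso_at D E R p -> iso_at E D (fun x y => R y x) p.
Proof.
  intros [Hdom Htot Honto Hfun Hinj Hord]. constructor; eauto.
  - intros x y q Hq H. apply and_comm. eauto.
  - intros x y x' y' q Hq H H'. apply iff_sym. eauto.
Qed.

Lemma iso_at_identity (D : T -> Prop) (p : P) :
  (forall t, D t) -> iso_at D D (fun x y => ro_ground P (x = y)) p.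
Proof.
  intros HD. constructor; simpl.
  - auto.
  - intros x _ q _. now exists q; split; [|exists x].
  - intros x _ q _. now exists q; split; [|exists x].
  - congruence.
  - congruence.
  - intros x y x' y' q _ <- <-. reflexivity.
Qed.

Lemma iso_at_restrict_cone (R : T -> T -> regular_open P) (x y : T) (p : P) :
  iso_at (fun _ => True) (fun _ => True) R p -> R x y p ->
  iso_at (cone x) (cone y)
    (fun a b => ro_and (ro_ground P (cone x a)) (R a b)) p.
Proof.
  intros [_ Htot Honto Hfun Hinj Hord] Hxy. constructor.
  - intros a b q Hq [Ha Hab]. split; [exact Ha|].
    apply (Hord x y a b q); eauto using ro_mono.
  - intros a Ha q Hq. destruct (Htot a I q Hq) as (r & Hr & b & Hab).
    exists r. split; [exact Hr|]. now exists b.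
  - intros b Hb q Hq. destruct (Honto b I q Hq) as (r & Hr & a & Hab).
    exists r. split; [exact Hr|]. exists a. split; [|exact Hab].
    apply (Hord x y a b r); eauto using ro_mono, cle_trans.
  - intros a b b' q Hq [_ Hab] [_ Hab']. eauto.
  - intros a a' b q Hq [_ Hab] [_ Hab']. eauto.
  - intros a b a' b' q Hq [_ Hab] [_ Hab']. eauto.
Qed.

End Isomorphisms.

(** * Interpretations of universes *)

(** A logical relation: every statement built from the connectives and from
    related names denotes its counterpart over [boolean_valued P].  The index
    types of a quantifier may differ, as a quantifier over subsets ranges over
    the names of its universe. *)
Record interpretation (M : universe) (P : forcing_notion) := Interpretation {
  names : bit M -> regular_open P -> Prop;
  denotes : form M -> form (boolean_valued P) -> Prop;
  denotes_equiv : forall phi X Y,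
    denotes phi X -> (forall p, ro_mem X p <-> ro_mem Y p) -> denotes phi Y;
  denotes_is_in : forall b X,
    names b X -> denotes (is_in b) (is_in (u := boolean_valued P) X);
  denotes_ground : forall A, denotes (fground A) (fground A);
  denotes_and : forall phi psi X Y,
    denotes phi X -> denotes psi Y -> denotes (fand phi psi) (fand X Y);
  denotes_imp : forall phi psi X Y,
    denotes phi X -> denotes psi Y -> denotes (fimp phi psi) (fimp X Y);
  denotes_all_over : forall A B (phi : A -> form M) X,
    (forall a, exists b : B, denotes (phi a) (X b)) ->
    (forall b, exists a, denotes (phi a) (X b)) ->
    denotes (fall A phi) (fall B X);
  denotes_ex_over : forall A B (phi : A -> form M) X,
    (forall a, exists b : B, denotes (phi a) (X b)) ->
    (forall b, exists a, denotes (phi a) (X b)) ->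
    denotes (fex A phi) (fex B X)
}.

Definition exhaustive (M : universe) (P : forcing_notion)
    (I : interpretation M P) :=
  (exists value, forall b, names I b (value b)) /\
  (exists name, forall X, names I (name X) X).

Section Denotations.

Context (M : universe) (P : forcing_notion) (I : interpretation M P).

Notation VP := (boolean_valued P).

Lemma denotes_all (A : Type) (phi : A -> form M) (X : A -> form VP) :
  (forall a, denotes I (phi a) (X a)) -> denotes I (fall A phi) (fall A X).
Proof. intros H. apply denotes_all_over; eauto. Qed.

Lemma denotes_ex (A : Type) (phi : A -> form M) (X : A -> form VP) :
  (forall a, denotes I (phi a) (X a)) -> denotes I (fex A phi) (fex A X).
Proof. intros H. apply denotes_ex_over; eauto. Qed.

#[local] Hint Resolve denotes_is_in denotes_ground denotes_and denotes_imp
  denotes_all denotes_ex : core.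

Lemma denotes_all_stronger (T : tree) (t : T) (phi : T -> form M)
    (X : T -> form VP) :
  (forall s, denotes I (phi s) (X s)) ->
  denotes I (all_stronger t phi) (all_stronger t X).
Proof. unfold all_stronger. auto. Qed.

Lemma denotes_some_stronger (T : tree) (t : T) (phi : T -> form M)
    (X : T -> form VP) :
  (forall s, denotes I (phi s) (X s)) ->
  denotes I (some_stronger t phi) (some_stronger t X).
Proof. unfold some_stronger. auto. Qed.

Lemma denotes_isomorphism (T : tree) (D E : T -> Prop) (R : T -> T -> bit M)
    (X : T -> T -> regular_open P) :
  (forall x y, names I (R x y) (X x y)) ->
  denotes I (isomorphism D E R) (isomorphism (M := VP) D E X).
Proof. unfold isomorphism. auto 20. Qed.

Lemma denotes_cofinal_branch (alpha : ordinal) (T : alpha_tree alpha)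
    (B : T -> bit M) (X : T -> regular_open P) :
  (forall t, names I (B t) (X t)) ->
  denotes I (cofinal_branch B) (cofinal_branch (M := VP) X).
Proof. unfold cofinal_branch. auto 20. Qed.

Lemma denotes_same_set (A : Type) (B C : A -> bit M)
    (X Y : A -> regular_open P) :
  (forall a, names I (B a) (X a)) -> (forall a, names I (C a) (Y a)) ->
  denotes I (same_set B C) (same_set (M := VP) X Y).
Proof. unfold same_set, fiff. auto 20. Qed.

Context (I_exhaustive : exhaustive I).

Lemma exhaustive_sets (A : Type)
    (related : (A -> bit M) -> (A -> regular_open P) -> Prop) :
  (forall B X, (forall a, names I (B a) (X a)) -> related B X) ->
  (forall B, exists X, related B X) /\ (forall X, exists B, related B X).
Proof.
  intros Hrelated. destruct I_exhaustive as [(value & Hv) (name & Hn)]. split.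
  - intros B. exists (fun a => value (B a)). auto.
  - intros X. exists (fun a => name (X a)). auto.
Qed.

Lemma exhaustive_relations (A B : Type)
    (related : (A -> B -> bit M) -> (A -> B -> regular_open P) -> Prop) :
  (forall R X, (forall a b, names I (R a b) (X a b)) -> related R X) ->
  (forall R, exists X, related R X) /\ (forall X, exists R, related R X).
Proof.
  intros Hrelated. destruct I_exhaustive as [(value & Hv) (name & Hn)]. split.
  - intros R. exists (fun a b => value (R a b)). auto.
  - intros X. exists (fun a b => name (X a b)). auto.
Qed.

Lemma denotes_totally_rigid (T : tree) :
  denotes I (totally_rigid M T) (totally_rigid VP T).
Proof.
  unfold totally_rigid.
  repeat first [apply denotes_all; intro | apply denotes_imp; auto].
  apply denotes_ex_over; apply exhaustive_relations, denotes_isomorphism.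
Qed.

Lemma denotes_rigid (T : tree) : denotes I (rigid M T) (rigid VP T).
Proof.
  assert (nontrivial_automorphism : forall (R : T -> T -> bit M) X,
    (forall x y, names I (R x y) (X x y)) ->
    denotes I (fand (automorphism R) (nontrivial R))
      (fand (automorphism (M := VP) X) (nontrivial (M := VP) X))).
  { intros R X HR. apply denotes_and.
    - now apply denotes_isomorphism.
    - unfold nontrivial. auto 20. }
  unfold rigid. apply denotes_imp; auto.
  apply denotes_ex_over; apply exhaustive_relations, nontrivial_automorphism.
Qed.

End Denotations.

Program Definition trivial_forcing : forcing_notion :=
  {| condition := unit; cle := fun _ _ => True |}.
Next Obligation. now split. Qed.

Program Definition V_interpretation : interpretation V trivial_forcing :=
  {| names := fun b X => b <-> ro_mem X tt;
     denotes := fun phi X => phi <-> ro_mem X tt |}.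
Next Obligation. intros phi X Y HX HXY. exact (iff_trans HX (HXY tt)). Qed.
Next Obligation. trivial. Qed.
Next Obligation. intros A. exact (iff_refl A). Qed.
Next Obligation.
  intros phi psi X Y [] []. split; intros []; split; auto.
Qed.
Next Obligation.
  intros phi psi X Y [HX HX'] [HY HY']. split.
  - intros H [] _ Xtt. apply HY, H, HX', Xtt.
  - intros H Hphi. apply HY', (H tt I), HX, Hphi.
Qed.
Next Obligation.
  intros A B phi X Hphi HX. split.
  - intros H b. destruct (HX b) as [a Ha]. apply Ha, H.
  - intros H a. destruct (Hphi a) as [b Hb]. apply Hb, H.
Qed.
Next Obligation.
  intros A B phi X Hphi HX. split.
  - intros [a H]. destruct (Hphi a) as [b Hb].
    apply (forces_exists (P := trivial_forcing) (a := b)), Hb, H.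
  - intros H. destruct (H tt I) as ([] & _ & b & Xb).
    destruct (HX b) as [a Ha]. exists a. now apply Ha.
Qed.

Lemma V_exhaustive : exhaustive V_interpretation.
Proof.
  split.
  - now exists (ro_ground trivial_forcing).
  - now exists (fun X : regular_open trivial_forcing => X tt).
Qed.

Program Definition tree_product (T : tree) (P : forcing_notion) :
    forcing_notion :=
  {| condition := T * P;
     cle := fun x y => tle (fst x) (fst y) /\ cle (snd x) (snd y) |}.
Next Obligation.
  intros T P. split.
  - now split.
  - intros x y z [] []. split; eauto using tle_trans, cle_trans.
Qed.

Canonical tree_product.

Section Extension.

Context (T : tree) (P : forcing_notion).

Notation TP := (tree_product T P).

Program Definition fiber (X : regular_open TP) (t : T) : regular_open P :=
  {| ro_mem := fun p => X (t, p) |}.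
Next Obligation. intros X t p q Hpq. apply ro_mono. now split. Qed.
Next Obligation.
  intros X t p H. apply ro_dense. intros [s q] [Hs Hq].
  destruct (H q Hq) as (r & Hr & Xr). exists (s, r).
  split; [now split|]. apply ro_mono with (2 := Xr). now split.
Qed.

Lemma forces_densely_stronger_exists (A : Type)
    (phi : A -> T -> form (boolean_valued P)) (t : T) (p : P) :
  all_stronger t (fun s => some_stronger s (fun r => fex A (fun a => phi a r)))
    p <->
  densely (fun x => exists a, phi a (fst x) (snd x)) (t, p).
Proof.
  split.
  - intros H [s q] [Hs Hq].
    destruct (H s q Hq Hs q (cle_refl q)) as (r & Hr & u & Hu & Hex).
    destruct (Hex r (cle_refl r)) as (v & Hv & a & Ha).
    exists (u, v). split; [|now exists a].
    split; [exact Hu | exact (cle_trans Hr Hv)].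
  - intros H s q Hq Hs r Hr.
    destruct (H (s, r)) as ([u v] & [Hu Hv] & a & Ha).
    { split; [exact Hs | exact (cle_trans Hq Hr)]. }
    exists v. split; [exact Hv|]. exists u. split; [exact Hu|].
    now apply forces_exists with a.
Qed.

Definition evaluation (U : T -> regular_open P) : regular_open TP :=
  regularize (fun x => exists s, tle s (fst x) /\ U s (snd x)).

Context (M : universe) (I : interpretation M P).

Program Definition extension_interpretation :
    interpretation (extension T M) TP :=
  {| names := fun u X => exists U, (forall s, names I (u s) (U s)) /\
       forall x, evaluation U x <-> ro_mem X x;
     denotes := fun phi X => forall t, denotes I (phi t) (fiber X t) |}.
Next Obligation.
  intros phi X Y H HXY t. eapply denotes_equiv; [apply H|].
  intros p. apply (HXY (t, p)).
Qed.
Next Obligation.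
  intros u X (U & HU & HX) t.
  eapply denotes_equiv.
  - apply denotes_all_stronger. intros s. apply denotes_some_stronger.
    intros r. apply denotes_ex. intros a.
    exact (denotes_and (denotes_ground I (tle a r)) (denotes_is_in (HU a))).
  - intros p. refine (iff_trans _ (HX (t, p))).
    apply (forces_densely_stronger_exists (A := T)).
Qed.
Next Obligation.
  intros A t. eapply denotes_equiv; [apply denotes_ground | reflexivity].
Qed.
Next Obligation.
  intros phi psi X Y HX HY t.
  eapply denotes_equiv; [exact (denotes_and (HX t) (HY t)) | reflexivity].
Qed.
Next Obligation.
  intros phi psi X Y HX HY t. eapply denotes_equiv.
  - apply denotes_all_stronger. intros s.
    exact (denotes_imp (HX s) (HY s)).
  - intros p. split.
    + intros H [s q] [Hs Hq]. exact (H s q Hq Hs q (cle_refl q)).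
    + intros H s q Hq Hs r Hr. apply (H (s, r)).
      split; [exact Hs | eapply cle_trans; eauto].
Qed.
Next Obligation.
  intros A B phi X Hphi HX t. eapply denotes_equiv.
  - apply (denotes_all_over (X := fun b => fiber (X b) t)).
    + intros a. destruct (Hphi a) as [b Hb]. exists b. apply Hb.
    + intros b. destruct (HX b) as [a Ha]. exists a. apply Ha.
  - reflexivity.
Qed.
Next Obligation.
  intros A B phi X Hphi HX t. eapply denotes_equiv.
  - apply denotes_all_stronger. intros s. apply denotes_some_stronger.
    intros r. apply (denotes_ex_over (X := fun b => fiber (X b) r)).
    + intros a. destruct (Hphi a) as [b Hb]. exists b. apply Hb.
    + intros b. destruct (HX b) as [a Ha]. exists a. apply Ha.
  - intros p.
    refine (iff_trans (forces_densely_stronger_exists _ t p) _).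
    split; intros H x Hx; destruct (H x Hx) as ([s q] & Hsq); now exists (s, q).
Qed.

Lemma extension_exhaustive :
  exhaustive I -> exhaustive extension_interpretation.
Proof.
  intros [(value & Hvalue) (name & Hname)]. split.
  - exists (fun u => evaluation (fun s => value (u s))). intros u.
    now exists (fun s => value (u s)).
  - exists (fun X s => name (fiber X s)). intros X. exists (fiber X).
    split; [auto|]. intros x. split; intros H.
    + apply ro_dense. intros y Hy.
      destruct (H y Hy) as (z & Hz & s & Hs & Xs). exists z.
      split; [exact Hz|]. apply ro_mono with (2 := Xs). now split.
    + intros [t p] Hy. exists (t, p). split; [apply cle_refl|]. exists t.
      split; [apply tle_refl|]. exact (ro_mono Hy H).
Qed.

End Extension.

(** * Projections of forcing notions *)

Record projection (Q P : forcing_notion) := Projection {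
  proj :> Q -> P;
  proj_mono : forall q r, cle q r -> cle (proj q) (proj r);
  proj_lift : forall q p, cle (proj q) p -> exists r, cle q r /\ cle p (proj r)
}.

Section Pullback.

Context (Q P : forcing_notion) (f : projection Q P).

Lemma densely_pullback (X : regular_open P) (q : Q) :
  densely (fun r => X (f r)) q <-> X (f q).
Proof.
  split.
  - intros H. apply ro_dense. intros p Hp.
    destruct (proj_lift Hp) as (r & Hr & Hpr).
    destruct (H r Hr) as (s & Hs & Xs). exists (f s).
    split; [|exact Xs]. eauto using cle_trans, proj_mono.
  - intros Xq r Hr. exists r. eauto using ro_mono, proj_mono.
Qed.

Program Definition pullback (X : regular_open P) : regular_open Q :=
  {| ro_mem := fun q => X (f q) |}.
Next Obligation. intros X q r Hr. apply ro_mono, proj_mono, Hr. Qed.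
Next Obligation. intros X q. apply densely_pullback. Qed.

Program Definition pullback_interpretation :
    interpretation (boolean_valued P) Q :=
  {| names := fun X Y => forall q, ro_mem X (f q) <-> ro_mem Y q;
     denotes := fun X Y => forall q, ro_mem X (f q) <-> ro_mem Y q |}.
Next Obligation. intros X Y Z HXY HYZ q. exact (iff_trans (HXY q) (HYZ q)). Qed.
Next Obligation. trivial. Qed.
Next Obligation. intros A q. exact (iff_refl A). Qed.
Next Obligation.
  intros X X' Y Y' HX HX' q. destruct (HX q), (HX' q).
  split; intros []; split; auto.
Qed.
Next Obligation.
  intros X X' Y Y' HX HX' q. split; intros H.
  - intros r Hr Yr. apply HX', H, HX, Yr. now apply proj_mono.
  - intros p Hp Xp. apply ro_dense. intros p' Hp'.
    destruct (proj_lift (cle_trans Hp Hp')) as (r & Hr & Hpr).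
    exists (f r). split; [exact Hpr|]. apply HX', H, HX; [exact Hr|].
    eauto using ro_mono, cle_trans.
Qed.
Next Obligation.
  intros A B X Y HXY HYX q. split.
  - intros H b. destruct (HYX b) as [a Ha]. apply Ha, H.
  - intros H a. destruct (HXY a) as [b Hb]. apply Hb, H.
Qed.
Next Obligation.
  intros A B X Y HXY HYX q. rewrite <- densely_pullback. split; intros H r Hr.
  - destruct (H r Hr) as (s & Hs & Ex).
    destruct (Ex _ (cle_refl (f s))) as (p & Hp & a & Xa).
    destruct (proj_lift Hp) as (u & Hu & Hpu). exists u.
    split; [eauto using cle_trans|].
    destruct (HXY a) as [b Hb]. exists b. apply Hb.
    eauto using ro_mono.
  - destruct (H r Hr) as (s & Hs & b & Yb). exists s. split; [exact Hs|].
    destruct (HYX b) as [a Ha]. apply (forces_exists (a := a)).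
    now apply Ha.
Qed.

Lemma pullback_isomorphism (T : tree) (D E : T -> Prop)
    (R : T -> T -> regular_open P) (q : Q) :
  isomorphism (M := boolean_valued P) D E R (f q) <->
  isomorphism (M := boolean_valued Q) D E (fun x y => pullback (R x y)) q.
Proof. now apply (denotes_isomorphism (I := pullback_interpretation)). Qed.

Lemma pullback_cofinal_branch (alpha : ordinal) (T : alpha_tree alpha)
    (B : T -> regular_open P) (q : Q) :
  cofinal_branch (M := boolean_valued P) B (f q) <->
  cofinal_branch (M := boolean_valued Q) (fun t => pullback (B t)) q.
Proof. now apply (denotes_cofinal_branch (I := pullback_interpretation)). Qed.

Lemma pullback_same_set (A : Type) (X Y : A -> regular_open P) (q : Q) :
  same_set (M := boolean_valued P) X Y (f q) <->
  same_set (M := boolean_valued Q)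
    (fun a => pullback (X a)) (fun a => pullback (Y a)) q.
Proof. now apply (denotes_same_set (I := pullback_interpretation)). Qed.

End Pullback.

Program Definition product_snd (T : tree) (P : forcing_notion) :
    projection (tree_product T P) P :=
  {| proj := snd |}.
Next Obligation. now intros T P x y []. Qed.
Next Obligation.
  intros T P [t p] q Hq. exists (t, q). now repeat split.
Qed.

Program Definition product_map (T : tree) (Q P : forcing_notion)
    (f : projection Q P) : projection (tree_product T Q) (tree_product T P) :=
  {| proj := fun x => (fst x, f (snd x)) |}.
Next Obligation. intros T Q P f x y []. split; [|apply proj_mono]; trivial. Qed.
Next Obligation.
  intros T Q P f [t q] [s p] [Hs Hp]. destruct (proj_lift Hp) as (r & Hr & Hpr).
  exists (s, r). now repeat split.
Qed.

Lemma names_check (T : tree) (M : universe) (P : forcing_notion)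
    (I : interpretation M P) (A : Type) (B : A -> bit M)
    (X : A -> regular_open P) (a : A) :
  names I (B a) (X a) ->
  names (extension_interpretation T I) (check T B a)
    (pullback (product_snd T P) (X a)).
Proof.
  intros HX. exists (fun _ => X a). split; [trivial|]. intros x.
  rewrite <- (densely_pullback (product_snd T P) (X a) x).
  split; intros H y Hy; destruct (H y Hy) as (z & Hz & Xz);
    exists z; (split; [exact Hz|]).
  - now destruct Xz as (s & _ & Xs).
  - now exists (fst z).
Qed.

(** * Rigidity *)

Section Rigidity.

Context (T : tree).

Lemma forces_totally_rigid (P : forcing_notion) (p : P) :
  totally_rigid (boolean_valued P) T p <->
  forall (s t : T) R q, s <> t -> cle p q -> ~ iso_at (cone s) (cone t) R q.
Proof.
  split.
  - intros H s t R q Hst Hq HR.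
    apply (proj1 (forces_not_exists _ _) (H s t p (cle_refl p) Hst) R q Hq).
    now apply forces_isomorphism.
  - intros H s t q Hq Hst. apply forces_not_exists. intros R r Hr HR.
    apply (H s t R r Hst); [eauto using cle_trans|].
    now apply forces_isomorphism.
Qed.

Lemma forces_rigid (P : forcing_notion) (p : P) :
  rigid (boolean_valued P) T p <->
  forall R q, cle p q -> iso_at (fun _ : T => True) (fun _ : T => True) R q ->
    forall x y, R x y q -> x = y.
Proof.
  unfold rigid. rewrite forces_not_exists. split.
  - intros H R q Hq HR x y Hxy. apply NNPP. intros Hne. apply (H R q Hq).
    split; [now apply forces_isomorphism|].
    apply forces_exists with x, forces_exists with y. now split.
  - intros H R q Hq [HR Hnt].
    destruct (Hnt q (cle_refl q)) as (r & Hr & x & Hx).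
    destruct (Hx r (cle_refl r)) as (u & Hu & y & Hxy & Hne).
    assert (Hqu : cle q u) by eauto using cle_trans.
    apply Hne, (H R u); [eauto using cle_trans | | exact Hxy].
    apply forces_isomorphism, (ro_mono Hqu HR).
Qed.

Lemma totally_rigid_rigid (P : forcing_notion) (p : P) :
  totally_rigid (boolean_valued P) T p -> rigid (boolean_valued P) T p.
Proof.
  rewrite forces_totally_rigid, forces_rigid. intros H R q Hq HR x y Hxy.
  apply NNPP. intros Hne.
  exact (H x y _ q Hne Hq (iso_at_restrict_cone HR Hxy)).
Qed.

Context (Q P : forcing_notion) (f : projection Q P) (q : Q).

Lemma iso_at_pullback (D E : T -> Prop) (R : T -> T -> regular_open P)
    (r : Q) (p : P) :
  cle p (f r) -> iso_at D E R p -> iso_at D E (fun x y => pullback f (R x y)) r.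
Proof.
  rewrite <- !forces_isomorphism. intros Hp HR.
  exact (proj1 (pullback_isomorphism f D E R r) (ro_mono Hp HR)).
Qed.

Lemma totally_rigid_projection :
  totally_rigid (boolean_valued Q) T q ->
  totally_rigid (boolean_valued P) T (f q).
Proof.
  rewrite !forces_totally_rigid. intros H s t R p Hst Hp HR.
  destruct (proj_lift Hp) as (r & Hr & Hpr).
  exact (H s t _ r Hst Hr (iso_at_pullback Hpr HR)).
Qed.

Lemma rigid_projection :
  rigid (boolean_valued Q) T q -> rigid (boolean_valued P) T (f q).
Proof.
  rewrite !forces_rigid. intros H R p Hp HR x y Hxy.
  destruct (proj_lift Hp) as (r & Hr & Hpr).
  apply (H _ r Hr (iso_at_pullback Hpr HR)). exact (ro_mono Hpr Hxy).
Qed.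

End Rigidity.

(** * New cofinal branches *)

Section NewBranches.

Local Open Scope form_scope.

Context (alpha : ordinal) (T : alpha_tree alpha) (P : forcing_notion).

Notation TP := (tree_product T P).
Notation VTP := (boolean_valued TP).

Lemma cofinal_branch_intro (B : T -> regular_open TP) (x : TP) :
  (forall s t y, cle x y -> B s y -> B t y -> comparable s t) ->
  (forall b, densely (fun y => exists t, B t y /\ level t = b) x) ->
  cofinal_branch (M := VTP) B x.
Proof.
  intros Hchain Hcof. refine (conj _ (conj _ _)).
  - intros s t y Hy Bs z Hz Bt.
    apply (Hchain s t z); eauto using cle_trans, ro_mono.
  - intros t y Hy Hcomp. apply ro_dense. intros z Hz.
    destruct (Hcof (level t) z) as (u & Hu & s & Bs & Hl);
      [eauto using cle_trans|].
    exists u. split; [exact Hu|].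
    rewrite <- (comparable_level_eq (Hcomp s u (cle_trans Hz Hu) Bs) Hl).
    exact Bs.
  - exact Hcof.
Qed.

Definition new_branch (B : T -> regular_open TP) : form VTP :=
  cofinal_branch (M := VTP) B &&&
  ALL X : T -> regular_open P,
    !! same_set (M := VTP) B (fun t => pullback (product_snd T P) (X t)).

Definition unique_new_branch : form VTP :=
  EX B : T -> regular_open TP, new_branch B &&&
    ALL C : T -> regular_open TP, new_branch C ==> same_set (M := VTP) C B.

Section Denotations.

Context (M : universe) (I : interpretation M P) (I_exhaustive : exhaustive I).

Notation J := (extension_interpretation T I).

Lemma denotes_new_branch (B : T -> bit (extension T M))
    (X : T -> regular_open TP) :
  (forall t, names J (B t) (X t)) ->
  denotes J (new_cofinal_branch B) (new_branch X).
Proof.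
  intros HB. apply denotes_and; [now apply denotes_cofinal_branch|].
  apply denotes_all_over; apply (exhaustive_sets I_exhaustive); intros C Y HC;
    (apply denotes_imp; [|apply denotes_ground]);
    (apply denotes_same_set; [exact HB|]); intros t; apply names_check, HC.
Qed.

Lemma denotes_UBP : denotes I (UBP M T) (fiber unique_new_branch root).
Proof.
  pose proof (extension_exhaustive T I_exhaustive) as J_exhaustive.
  enough (H : denotes J (@exactly_one_new_cofinal_branch M alpha T)
    unique_new_branch) by exact (H root).
  apply denotes_ex_over; apply (exhaustive_sets J_exhaustive); intros B X HB;
    (apply denotes_and; [now apply denotes_new_branch|]);
    apply denotes_all_over; apply (exhaustive_sets J_exhaustive);
    intros C Y HC;
    (apply denotes_imp;
      [now apply denotes_new_branch | now apply denotes_same_set]).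
Qed.

End Denotations.

(** A top node decides every name, so that forcing with a tree that has a top
    level adds nothing. *)
Lemma new_branch_limit_height (B : T -> regular_open TP) (x : TP) :
  normal T -> new_branch B x -> limit_height alpha.
Proof.
  intros T_normal [_ Hnew] b Hb. destruct x as [t p].
  destruct (level_above T_normal t b) as (s & Hs & Hl).
  assert (s_maximal : forall r, tle s r -> s = r).
  { intros r Hr. apply comparable_level_eq; [now left|].
    apply ole_antisym; [now apply level_ole|].
    apply ole_trans with b; [apply Hb | exact Hl]. }
  apply (Hnew (fun t => fiber (B t) s) (s, p)); [now split|].
  apply forces_same_set. intros r [s' q] [Hs' _].
  apply s_maximal in Hs'. simpl in Hs'. now subst s'.
Qed.

Lemma unique_new_branch_limit_height (x : TP) :
  normal T -> unique_new_branch x -> limit_height alpha.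
Proof.
  intros T_normal H. destruct (H x (cle_refl x)) as (y & _ & B & HB & _).
  exact (new_branch_limit_height T_normal HB).
Qed.

End NewBranches.

Section ConeIsomorphisms.

Context (alpha : ordinal) (T : alpha_tree alpha) (P : forcing_notion).

Lemma iso_at_predecessor (s t : T) (R : T -> T -> regular_open P) (p : P)
    (x y : T) (c : alpha) :
  iso_at (cone s) (cone t) R p -> R x y p -> ole (level t) c ->
  olt c (level y) ->
  exists q x' y',
    cle p q /\ R x' y' q /\ tlt x' x /\ tlt y' y /\ level y' = c.
Proof.
  intros HR Hxy Htc Hc.
  destruct (iso_dom HR (cle_refl p) Hxy) as [_ Ey].
  destruct (level_onto Hc) as (y' & [Hy' Hne] & <-).
  assert (Ey' : cone t y') by (now apply tle_of_level with y).
  destruct (iso_onto HR Ey' (cle_refl p)) as (q & Hq & x' & Hxy').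
  exists q, x', y'. repeat split; trivial.
  - apply (iso_order HR Hq Hxy' (ro_mono Hq Hxy)), Hy'.
  - intros ->. apply Hne, (iso_fun HR Hq Hxy' (ro_mono Hq Hxy)).
Qed.

Lemma iso_at_level_mono (s t : T) (R : T -> T -> regular_open P) (p : P) :
  iso_at (cone s) (cone t) R p ->
  forall x y x' y', R x y p -> R x' y' p ->
    ole (level x) (level x') -> ole (level y) (level y').
Proof.
  intros HR x y. remember (level y) as b eqn:Hb.
  revert x y p HR Hb.
  induction b as [b IH]
    using (well_founded_induction (@olt_well_founded alpha)).
  intros x y p HR -> x' y' Hxy Hxy' Hl.
  destruct (ole_or_olt (level y) (level y')) as [H|Hlt]; [exact H|exfalso].
  destruct (iso_dom HR (cle_refl p) Hxy') as [_ Ey'].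
  destruct (iso_at_predecessor HR Hxy (level_ole Ey') Hlt)
    as (q & a & b & Hq & Hab & La & _ & Hb).
  pose proof (iso_at_mono Hq HR) as HRq.
  destruct (iso_dom HRq (cle_refl q) Hab) as [Da _].
  pose proof (olt_ole_trans (level_lt La) Hl) as Hal.
  destruct (iso_at_predecessor (iso_at_inverse HRq) (ro_mono Hq Hxy')
    (level_ole Da) Hal)
    as (r & b' & a' & Hr & Hab' & Lb' & _ & Ha').
  apply (olt_not_ole (level_lt Lb')). rewrite <- Hb.
  apply (IH (level b)) with (x := a) (y := b) (p := r) (x' := a').
  - now rewrite Hb.
  - exact (iso_at_mono Hr HRq).
  - reflexivity.
  - exact (ro_mono Hr Hab).
  - exact Hab'.
  - rewrite Ha'. apply ole_refl.
Qed.

End ConeIsomorphisms.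

Section ImageBranch.

Context (alpha : ordinal) (T : alpha_tree alpha) (P : forcing_notion).

Notation TP := (tree_product T P).

(** The downward closure of the image under [R] of the generic branch. *)
Definition image_branch (R : T -> T -> regular_open P) (t : T) :
    regular_open TP :=
  regularize (fun x =>
    exists y z, tle y (fst x) /\ tle t z /\ R y z (snd x)).

Lemma image_branch_intro (R : T -> T -> regular_open P) (t y z : T) (x : TP) :
  tle y (fst x) -> tle t z -> R y z (snd x) -> image_branch R t x.
Proof.
  intros Hy Hz HR. apply densely_intro; [|now exists y, z].
  intros u v [Hu Hu'] (a & b & Ha & Hb & Hab). exists a, b.
  eauto using tle_trans, ro_mono.
Qed.

Definition generic_branch : T -> regular_open TP :=
  image_branch (fun x y => ro_ground P (x = y)).

Lemma generic_branch_compatible (t : T) (x : TP) :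
  generic_branch t x -> exists y : TP, cle x y /\ tle t (fst y).
Proof.
  intros H. destruct (H x (cle_refl x)) as (y & Hy & a & b & Ha & Hb & E).
  simpl in E. subst b. exists y. split; [exact Hy | eauto using tle_trans].
Qed.

Context (T_normal : normal T) (limit : limit_height alpha).
Context (s t r : T) (R : T -> T -> regular_open P) (p : P).
Context (HR : iso_at (cone s) (cone t) R p) (Hsr : tle s r).

Lemma image_branch_chain (a b : T) (x : TP) :
  cle (r, p) x -> image_branch R a x -> image_branch R b x -> comparable a b.
Proof.
  intros Hx Ha Hb.
  destruct (Ha x (cle_refl x)) as (x1 & Hx1 & y & z & Hy & Haz & Hyz).
  destruct (Hb x1 Hx1) as (x2 & Hx2 & y' & z' & Hy' & Hbz & Hyz').
  destruct (cle_trans Hx (cle_trans Hx1 Hx2)) as [_ Hp].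
  destruct Hx2 as [Hfst Hsnd].
  pose proof (ro_mono Hsnd Hyz) as Hyz2.
  apply (comparable_below Haz Hbz).
  destruct (predecessors_comparable (tle_trans Hy Hfst) Hy') as [H|H].
  - left. now apply (iso_order HR Hp Hyz2 Hyz').
  - right. now apply (iso_order HR Hp Hyz' Hyz2).
Qed.

Lemma image_branch_cofinal (b : alpha) :
  densely (fun x => exists a, image_branch R a x /\ level a = b) (r, p).
Proof.
  intros [u q] [Hu Hq]. simpl in Hu, Hq.
  destruct (level_above T_normal t b) as (z & Hz & Hbz).
  destruct (iso_onto HR Hz Hq) as (q1 & Hq1 & x & Hxz).
  assert (Hp1 : cle p q1) by eauto using cle_trans.
  destruct (level_above T_normal u (level x)) as (v & Hv & Hl).
  assert (Dv : cone s v) by (unfold cone; eauto using tle_trans).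
  destruct (iso_total HR Dv Hp1) as (q2 & Hq2 & y & Hvy).
  assert (Hp2 : cle p q2) by eauto using cle_trans.
  pose proof (iso_at_level_mono (iso_at_mono Hp2 HR) (ro_mono Hq2 Hxz) Hvy Hl)
    as Hzy.
  destruct (level_below (ole_trans Hbz Hzy)) as (a & Ha & Hla).
  exists (v, q2). split.
  - split; simpl; eauto using cle_trans.
  - exists a. split; [now apply image_branch_intro with v y | exact Hla].
Qed.

Lemma image_branch_splits (x : TP) :
  cle (r, p) x ->
  exists u1 u2 q a1 a2, cle x (u1, q) /\ cle x (u2, q) /\
    image_branch R a1 (u1, q) /\ image_branch R a2 (u2, q) /\
    ~ comparable a1 a2.
Proof.
  destruct x as [u q]. intros [Hu Hq]. simpl in Hu, Hq.
  destruct (incomparable_successors T_normal limit u)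
    as (u1 & u2 & Hu1 & Hu2 & Hincomp).
  assert (Du1 : cone s u1) by (unfold cone; eauto using tle_trans).
  assert (Du2 : cone s u2) by (unfold cone; eauto using tle_trans).
  destruct (iso_total HR Du1 Hq) as (q1 & Hq1 & a1 & Ha1).
  assert (Hp1 : cle p q1) by eauto using cle_trans.
  destruct (iso_total HR Du2 Hp1) as (q2 & Hq2 & a2 & Ha2).
  assert (Hp2 : cle p q2) by eauto using cle_trans.
  pose proof (ro_mono Hq2 Ha1) as Ha1'.
  exists u1, u2, q2, a1, a2. repeat split; simpl; eauto using cle_trans.
  - now apply image_branch_intro with u1 a1.
  - now apply image_branch_intro with u2 a2.
  - intros Ha. apply Hincomp. destruct Ha as [H|H].
    + left. now apply (iso_order HR Hp2 Ha1' Ha2).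
    + right. now apply (iso_order HR Hp2 Ha2 Ha1').
Qed.

(** Two conditions that differ in the generic branch only force incomparable
    nodes into the image; a set of the ground model equal to it would contain
    both. *)
Lemma image_branch_new : new_branch (image_branch R) (r, p).
Proof.
  split.
  - apply cofinal_branch_intro;
      [exact image_branch_chain | exact image_branch_cofinal].
  - intros X x Hx HX. rewrite forces_same_set in HX.
    destruct (image_branch_splits Hx)
      as (u1 & u2 & q & a1 & a2 & Hx1 & Hx2 & Ha1 & Ha2 & Hincomp).
    apply Hincomp, (image_branch_chain (cle_trans Hx Hx1)); [exact Ha1|].
    apply (HX a2 _ Hx1). now apply (HX a2 _ Hx2) in Ha2.
Qed.

End ImageBranch.

Section UniqueBranch.

Context (alpha : ordinal) (T : alpha_tree alpha) (T_normal : normal T).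

Lemma generic_branch_new (P : forcing_notion) (x : tree_product T P) :
  limit_height alpha -> new_branch (generic_branch (T := T) P) x.
Proof.
  intros limit. destruct x as [t p].
  apply (image_branch_new T_normal limit (s := root) (t := root)).
  - apply iso_at_identity. apply root_least.
  - apply root_least.
Qed.

(** If [t] were not below [s], some condition above [s] would be incomparable
    with [t]; but it forces that the image of the generic branch passes through
    [t] and, by uniqueness, is the generic branch. *)
Lemma unique_new_branch_iso_tle (P : forcing_notion) (p q : P) (s t : T)
    (R : T -> T -> regular_open P) :
  unique_new_branch T P (root, p) -> cle p q -> iso_at (cone s) (cone t) R q ->
  tle t s.
Proof.
  intros Hunique Hq HR.
  pose proof (unique_new_branch_limit_height T_normal Hunique) as limit.
  apply NNPP. intros Hts.
  destruct (incomparable_above T_normal limit Hts) as (r & Hr & Hincomp).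
  destruct (Hunique (r, q)) as ([u q'] & [Hu Hq'] & B & _ & HB).
  { split; [apply root_least | exact Hq]. }
  simpl in Hu, Hq'.
  pose proof (iso_at_mono Hq' HR) as HRq'.
  assert (Himage := HB _ (u, q') (cle_refl _)
    (image_branch_new T_normal limit HRq' (tle_trans Hr Hu))).
  assert (Hgeneric := HB _ (u, q') (cle_refl _)
    (generic_branch_new (u, q') limit)).
  rewrite forces_same_set in Himage, Hgeneric.
  destruct (iso_total HRq' (tle_refl s) (cle_refl q')) as (v & Hv & z & Hsz).
  assert (Huv : cle (f := tree_product T P) (u, q') (u, v)) by now split.
  assert (Ht : generic_branch P t (u, v)).
  { apply (Hgeneric t _ Huv), (Himage t _ Huv).
    apply image_branch_intro with s z; simpl; eauto using tle_trans.
    apply (iso_dom HRq' Hv Hsz). }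
  destruct (generic_branch_compatible Ht) as (y & [Hy _] & Hty).
  apply Hincomp, predecessors_comparable with (fst y); eauto using tle_trans.
Qed.

Lemma unique_new_branch_totally_rigid (P : forcing_notion) (p : P) :
  unique_new_branch T P (root, p) -> totally_rigid (boolean_valued P) T p.
Proof.
  rewrite forces_totally_rigid. intros Hunique s t R q Hst Hq HR.
  apply Hst, tle_antisym.
  - exact (unique_new_branch_iso_tle Hunique Hq (iso_at_inverse HR)).
  - exact (unique_new_branch_iso_tle Hunique Hq HR).
Qed.

Context (Q P : forcing_notion) (f : projection Q P).

Notation F := (product_map T f).

(** If the pulled back branch is a set [X] added by [Q], then [s] decides it:
    what a condition above [s] forces into it is in [X] regardless of the
    generic branch, hence is already forced by [s]. *)
Lemma new_branch_pullback (C : T -> regular_open (tree_product T P))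
    (x : tree_product T Q) :
  new_branch C (F x) -> new_branch (fun t => pullback F (C t)) x.
Proof.
  intros [HC Hnew]. split; [exact (proj1 (pullback_cofinal_branch F C x) HC)|].
  intros X [s q] Hx HX. rewrite forces_same_set in HX.
  apply (Hnew (fun t => fiber (C t) s) (s, f q)); [exact (proj_mono F Hx)|].
  apply forces_same_set. intros t [s' p] [Hs Hp]. simpl in Hs, Hp. split.
  - intros H. apply (ro_dense (r := fiber (C t) s)). intros p' Hp'.
    destruct (proj_lift (cle_trans Hp Hp')) as (r & Hr & Hpr).
    exists (f r). split; [exact Hpr|].
    apply (HX t (s, r)); [now split|]. apply (HX t (s', r)); [now split|].
    apply ro_mono with (2 := H). split; simpl; eauto using cle_trans.
  - intros H. apply ro_mono with (2 := H). now split.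
Qed.

Lemma unique_new_branch_projection (q : Q) :
  unique_new_branch T Q (root, q) -> unique_new_branch T P (root, f q).
Proof.
  intros Hunique.
  pose proof (unique_new_branch_limit_height T_normal Hunique) as limit.
  intros x [_ Hx]. exists x. split; [apply cle_refl|].
  exists (generic_branch (T := T) P). split; [now apply generic_branch_new|].
  intros C y Hy HC. apply ro_dense. intros [s p] Hz.
  assert (Hp : cle (f q) p)
    by (eapply cle_trans; [apply Hx|]; eapply cle_trans; [apply Hy | apply Hz]).
  destruct (proj_lift Hp) as (r & Hr & Hpr).
  destruct (Hunique (s, r)) as (w & [Hs Hrw] & B & _ & HB).
  { split; [apply root_least | exact Hr]. }
  assert (Hw : cle (f := tree_product T P) (s, p) (F w)).
  { split; [exact Hs|]. exact (cle_trans Hpr (proj_mono f Hrw)). }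
  exists (F w). split; [exact Hw|].
  assert (unique : forall D, new_branch D (F w) ->
    same_set (M := boolean_valued _) (fun t => pullback F (D t)) B w).
  { intros D HD. apply HB; [apply cle_refl | now apply new_branch_pullback]. }
  pose proof (unique C (ro_mono (cle_trans Hz Hw) HC)) as EC.
  pose proof (unique _ (generic_branch_new (F w) limit)) as EG.
  refine (proj2 (pullback_same_set F _ _ w) _).
  rewrite forces_same_set in EC, EG |- *. intros t v Hv.
  exact (iff_trans (EC t v Hv) (iff_sym (EG t v Hv))).
Qed.

End UniqueBranch.

Section GroundModel.

Notation one := trivial_forcing.

Lemma V_rigid_iff (T : tree) :
  rigid V T <-> rigid (boolean_valued one) T tt.
Proof. exact (denotes_rigid V_exhaustive T). Qed.

Lemma V_totally_rigid_iff (T : tree) :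
  totally_rigid V T <-> totally_rigid (boolean_valued one) T tt.
Proof. exact (denotes_totally_rigid V_exhaustive T). Qed.

Lemma V_UBP_iff (alpha : ordinal) (T : alpha_tree alpha) :
  UBP V T <-> unique_new_branch T one (root, tt).
Proof. exact (denotes_UBP T V_exhaustive). Qed.

Lemma absolutely_rigid_iff (T : tree) :
  absolutely_rigid T <->
  rigid (boolean_valued (tree_product T one)) T (root, tt).
Proof. exact (denotes_rigid (extension_exhaustive T V_exhaustive) T root). Qed.

Lemma absolutely_totally_rigid_iff (T : tree) :
  absolutely_totally_rigid T <->
  totally_rigid (boolean_valued (tree_product T one)) T (root, tt).
Proof.
  exact (denotes_totally_rigid (extension_exhaustive T V_exhaustive) T root).
Qed.

Lemma absolutely_UBP_iff (alpha : ordinal) (T : alpha_tree alpha) :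
  absolutely_UBP T <->
  unique_new_branch T (tree_product T one) (root, (root, tt)).
Proof. exact (denotes_UBP T (extension_exhaustive T V_exhaustive) root). Qed.

End GroundModel.

Theorem theorem1p2 (alpha : ordinal) (T : alpha_tree alpha)
    (alpha_le : le_omega1 alpha) (T_normal : normal T) :
  (absolutely_rigid T \/ totally_rigid V T -> rigid V T) /\
  (absolutely_totally_rigid T -> totally_rigid V T /\ absolutely_rigid T) /\
  (UBP V T -> totally_rigid V T) /\
  (absolutely_UBP T -> UBP V T /\ absolutely_totally_rigid T).
Proof.
  pose (f := product_snd T trivial_forcing).
  refine (conj _ (conj _ (conj _ _))).
  - intros [H%absolutely_rigid_iff|H%V_totally_rigid_iff]; apply V_rigid_iff.
    + exact (rigid_projection (f := f) H).
    + exact (totally_rigid_rigid H).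
  - intros H%absolutely_totally_rigid_iff. split.
    + apply V_totally_rigid_iff. exact (totally_rigid_projection (f := f) H).
    + apply absolutely_rigid_iff. exact (totally_rigid_rigid H).
  - intros H%V_UBP_iff. apply V_totally_rigid_iff.
    exact (unique_new_branch_totally_rigid T_normal H).
  - intros H%absolutely_UBP_iff. split.
    + apply V_UBP_iff. exact (unique_new_branch_projection T_normal (f := f) H).
    + apply absolutely_totally_rigid_iff.
      exact (unique_new_branch_totally_rigid T_normal H).
Qed.
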